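(* For every set $X$, the semigroup Hausdorff–Markov topology $\mathcal{HM}(\operatorname{Sym}(X))$ on $\operatorname{Sym}(X)$ is the topology of pointwise convergence.
   Context: $\operatorname{Sym}(X)$ is the symmetric group on $X$ (all permutations of $X$, composed from left to right and written on the right of their arguments). The topology of pointwise convergence on $\operatorname{Sym}(X)$ is the subspace topology inherited from the product space $X^X$, where each copy of $X$ is discrete; equivalently it has as a subbase the sets $\{f\in \operatorname{Sym}(X):(x)f=y\}$, $x,y\in X$. A topology $\tau$ on a semigroup $S$ is a semigroup topology if the semigroup operation $S\times S\to S$ is continuous with respect to $\tau$ (for groups, continuity of inversion is not required). The semigroup Hausdorff–Markov topology $\mathcal{HM}(S)$ is the intersection of all Hausdorff semigroup topologies on $S$. *)

(* Defs.v *)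
From HB Require Import structures.
From mathcomp Require Import all_boot all_classical topology.

Set Implicit Arguments.
Unset Strict Implicit.
Unset Printing Implicit Defensive.

Local Open Scope classical_set_scope.

Section SymmetricGroup.
Variable X : Type.

Record Sym : Type := Sym_mk { Sym_fun : X -> X; Sym_bij : bijective Sym_fun }.

HB.instance Definition _ := gen_eqMixin Sym.
HB.instance Definition _ := gen_choiceMixin Sym.

Lemma Sym_eqP (f g : Sym) : Sym_fun f =1 Sym_fun g -> f = g.
Proof.
case: f g => [f bij_f] [g bij_g] /= /funext fg; case: _ / fg bij_g => bij_g.
by congr Sym_mk; exact: Prop_irrelevance.
Qed.

Lemma Sym_inv_subproof (f : Sym) :
  exists g, cancel (Sym_fun f) g /\ cancel g (Sym_fun f).
Proof. by case: (Sym_bij f) => g fK gK; exists g. Qed.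

Definition Sym_invfun (f : Sym) : X -> X := sval (cid (Sym_inv_subproof f)).

Lemma Sym_funK (f : Sym) : cancel (Sym_fun f) (Sym_invfun f).
Proof. by rewrite /Sym_invfun; case: cid => g []. Qed.

Lemma Sym_invfunK (f : Sym) : cancel (Sym_invfun f) (Sym_fun f).
Proof. by rewrite /Sym_invfun; case: cid => g []. Qed.

Definition Sym_one : Sym := Sym_mk (Bijective (frefl id) (frefl id)).

Definition Sym_inv (f : Sym) : Sym :=
  Sym_mk (Bijective (@Sym_invfunK f) (@Sym_funK f)).

(* Permutations act on the right: f * g applies f first, then g. *)
Definition Sym_mul (f g : Sym) : Sym :=
  Sym_mk (bij_comp (Sym_bij g) (Sym_bij f)).

Lemma Sym_mulA : associative Sym_mul.
Proof. by move=> f g h; apply: Sym_eqP. Qed.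

Lemma Sym_1mul : left_id Sym_one Sym_mul.
Proof. by move=> f; apply: Sym_eqP. Qed.

Lemma Sym_mul1 : right_id Sym_one Sym_mul.
Proof. by move=> f; apply: Sym_eqP. Qed.

Lemma Sym_Vmul : left_inverse Sym_one Sym_inv Sym_mul.
Proof. by move=> f; apply: Sym_eqP => x; exact: Sym_invfunK. Qed.

Lemma Sym_mulV : right_inverse Sym_one Sym_inv Sym_mul.
Proof. by move=> f; apply: Sym_eqP => x; exact: Sym_funK. Qed.

HB.instance Definition _ :=
  isGroup.Build Sym Sym_mulA Sym_1mul Sym_mul1 Sym_Vmul Sym_mulV.

(* {classic X} is X itself, with a choiceType structure. *)
Definition Sym_incl : Sym -> {ptws X -> discrete_topology {classic X}} :=
  Sym_fun.

Definition pointwise_topology : topologicalType := initial_topology Sym_incl.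

End SymmetricGroup.

(* Explicit form of open, displayed with its space: two topologies on the same
   carrier are compared through their families of open sets. *)
Definition open_sets (T : topologicalType) : set_system T := @open T.
Arguments open_sets : clear implicits.

(* Continuity is joint: T * T carries the product topology. *)
Definition semigroup_topology (S : semigroupType) (tau : Topological S) : Prop :=
  let T : topologicalType := Topological.Pack tau in
  continuous ((fun p : S * S => (p.1 * p.2)%g) : T * T -> T).

(* An alias of S, endowed below with its Hausdorff-Markov topology. *)
Definition HM (S : semigroupType) : Type := S.

Section HausdorffMarkov.
Variable S : semigroupType.

Definition HM_open : set_system S :=
  [set U : set S | forall tau : Topological S,
    hausdorff_space (Topological.Pack tau) -> semigroup_topology tau ->
    open_sets (Topological.Pack tau) U].

Lemma HM_openT : HM_open setT.
Proof. by move=> tau _ _; exact: openT. Qed.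

Lemma HM_openI : setI_closed HM_open.
Proof. by move=> U V oU oV tau ht st; apply: openI; [exact: oU|exact: oV]. Qed.

Lemma HM_open_bigU (I : Type) (U : I -> set S) :
  (forall i, HM_open (U i)) -> HM_open (\bigcup_i U i).
Proof. by move=> oU tau ht st; apply: bigcup_open => i _; exact: oU. Qed.

HB.instance Definition _ := Choice.on (HM S).
HB.instance Definition _ :=
  isOpenTopological.Build (HM S) HM_openT HM_openI HM_open_bigU.

End HausdorffMarkov.

(* Main.v *)
Require Import Defs.
From mathcomp Require Import all_boot all_classical topology.

Set Implicit Arguments.
Unset Strict Implicit.
Unset Printing Implicit Defensive.

Local Open Scope classical_set_scope.

(** The topology of pointwise convergence is itself a Hausdorff semigroup
    topology, so it remains to see that each Hausdorff semigroup topology on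
    Sym X makes the stabiliser of every point a neighbourhood of 1: translations
    being continuous, the sets of the f with f x = y are then open. If X is
    finite this holds because a finite Hausdorff space is discrete. Let X be
    infinite and suppose that no stabiliser is a neighbourhood of 1.

    The separation axiom enters through transpositions. If f maps p to p' and
    fixes q, then (p q) f = f (p' q), products being read from left to right.
    As (p q) and (p' q) are distinct, they have disjoint neighbourhoods, so that
    all f close to 1 violate this equation: near 1, no f satisfies f p = p' and
    f q = q [unit_filter_sep]. The contradiction is to exhibit such an f in every
    neighbourhood of 1.

    The tool is a dichotomy for orbits. Let V be a neighbourhood of 1 and O the
    set of the images f x for f in V. If c fixes x, the neighbourhoods V and
    c^-1 V c intersect in a neighbourhood whose images of x lie in O and in c O.
    When O minus x can be injected into the complement of O, some involution
    c that fixes x moves O minus x off O, and then the intersection stabilises x. So O is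
    too large for this; in particular O is infinite, and two such sets O and O'
    always meet: of two disjoint sets one injects into the other, by the
    comparability of cardinals [permutable_meet].

    Inversion need not be continuous, but the inverses of the neighbourhoods
    of 1 satisfy the same axioms, so the dichotomy applies to preimages too.
    Given x and y, the images of x and the preimages of y under a neighbourhood W
    therefore meet: some z has z = f x and g z = y with f and g in W. Since W can
    be chosen with W W inside V, every V contains an element that maps x to y
    [unit_filter_transitive].

    This makes it possible to prescribe the image of one point and to repeat the
    argument for a second one. Choose p, q, p', z distinct. Among the f in W with
    f p = z, the images of q form again a set to which the dichotomy applies,
    and so do the preimages of q among the g in W with g z = p'. The two sets
    meet, and the product f g maps p to z to p' and q back to q
    [unit_filter_has_fix]. *)

(** * Filters invariant under permutations *)

(** Comparability of cardinals, in the form of an involution: a maximal partial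
    matching between A and B exhausts one of the two sets, and exchanging matched
    points is an involution because A and B are disjoint. *)
Lemma matching_involution (T : Type) (A B : set T) : A `&` B = set0 ->
  exists s : T -> T, [/\ involutive s,
    forall x, ~ A x -> ~ B x -> s x = x &
    (forall x, A x -> B (s x)) \/ (forall x, B x -> A (s x))].
Proof.
move=> AB0.
have AB x : A x -> B x -> False.
  by move=> Ax Bx; have : (A `&` B) x by []; rewrite AB0.
pose matching (M : set (T * T)) := (M `<=` A `*` B) /\
  (forall u v, M u -> M v -> u.1 = v.1 <-> u.2 = v.2).
have [|M [[MAB Mbij] Mmax]] := @Zorn_bigcup _ matching.
  move=> F Fm Ftot; split=> [u [M FM Mu]|u v [M FM Mu] [N FN Nv]].
    exact: (Fm _ FM).1.
  have [MN|NM] := Ftot _ _ FM FN.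
    exact: (Fm _ FN).2 (MN _ Mu) Nv.
  exact: (Fm _ FM).2 Mu (NM _ Nv).
pose E x y := M (x, y) \/ M (y, x).
have EC x y : E x y -> E y x by case=> H; [right|left].
have Efun x y z : E x y -> E x z -> y = z.
  move=> [xy|yx] [xz|zx].
  - exact/(Mbij _ _ xy xz).
  - by have [/= _ Bx] := MAB _ zx; have [/= Ax _] := MAB _ xy; case: (AB x).
  - by have [/= Ax _] := MAB _ xz; have [/= _ Bx] := MAB _ yx; case: (AB x).
  - exact/(Mbij _ _ yx zx).
have /choice[s sP] (x : T) : exists y, E x y \/ y = x /\ forall z, ~ E x z.
  by have [[y xy]|/forallNP nE] := pselect (exists y, E x y);
    [exists y; left|exists x; right].
have sE x y : E x y -> s x = y.
  by move=> xy; case: (sP x) => [xs|[_ /(_ _ xy)//]]; exact: Efun xs xy.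
exists s; split=> [x|x nAx nBx|].
- by case: (sP x) => [/EC/sE//|[sx _]]; rewrite !sx.
- by case: (sP x) => [[/MAB[]//|/MAB[]//]|[]].
have [Mtot|/existsNP[a /not_implyP[Aa nMa]]] :=
    pselect (forall a, A a -> exists b, M (a, b)).
  by left=> x /Mtot[y Mxy]; rewrite (sE x y); [case: (MAB _ Mxy)|left].
right=> b Bb; have [[a' Mab]|nMb] := pselect (exists a', M (a', b)).
  by rewrite (sE b a'); [case: (MAB _ Mab)|right].
(* Both a and b are unmatched, so adding the pair (a, b) contradicts maximality. *)
exfalso; apply: (Mmax (M `|` [set (a, b)])).
  by split=> [|sub]; [exact: subsetUl|apply: nMa; exists b; apply: sub; right].
split=> [u [/MAB//|->//]|u v [Mu|->] [Mv|->]//=]; first exact: Mbij.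
  by case: u Mu => x y /= Mu; split=> e; subst;
    [case: nMa; exists y|case: nMb; exists x].
by case: v Mv => x y /= Mv; split=> e; subst;
  [case: nMa; exists y|case: nMb; exists x].
Qed.

Section PermutableFilters.
Variable T : Type.
Implicit Types (F A : set T) (B : set_system T).

(** In the applications, B consists of the sets that contain all images of a
    given point under the permutations close to 1, or under those among them
    that satisfy a further condition; it is invariant because the
    neighbourhoods of 1 can be conjugated by permutations that fix F. *)
Definition permutable F B := Filter B /\ forall s : T -> T, involutive s ->
  (forall x, F x -> s x = x) -> forall A, B A -> B (s @^-1` A).

(** An involution fixing F and moving A minus F off A forces the member
    A `&` s @^-1` A of B inside F. *)
Lemma permutable_moved_off F B A (s : T -> T) : permutable F B ->
  involutive s -> (forall x, F x -> s x = x) -> B A ->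
  (forall x, A x -> ~ F x -> ~ A (s x)) -> B F.
Proof.
move=> [Bfilter Bperm] sK sF BA disj.
apply: filterS (filterI BA (Bperm _ sK sF _ BA)) => x [Ax Asx].
by apply: contrapT => /(disj _ Ax).
Qed.

(** A finite member would be moved off itself, into its infinite complement. *)
Lemma permutable_infinite F B A : infinite_set [set: T] -> finite_set F ->
  permutable F B -> ~ B F -> B A -> infinite_set A.
Proof.
move=> Tinf Ffin Bperm nBF BA Afin; apply: nBF.
have [|s [sK sid sAC]] := @matching_involution T (A `\` F) (~` (A `|` F)).
  by apply/seteqP; split=> // x [[Ax _] nAx]; apply: nAx; left.
apply: (permutable_moved_off Bperm sK) BA _ => [x Fx|x Ax nFx Asx].
  by apply: sid => [[]//|nAFx]; apply: nAFx; right.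
case: sAC => [sA|sC]; first by apply: (sA x) => //; left.
apply: Tinf; have AFfin : finite_set (A `|` F) by rewrite finite_setU.
rewrite -(setvU (A `|` F)) finite_setU; split=> //.
apply: sub_finite_set (finite_image s (finite_setD F Afin)) => y /sC sy.
by exists (s y); rewrite ?sK.
Qed.

(** If A1 and A2 were disjoint, one of them would inject into the other outside
    F1 and F2, and the corresponding involution would move it off itself. *)
Lemma permutable_meet F1 F2 B1 B2 A1 A2 :
  infinite_set [set: T] -> finite_set F1 -> finite_set F2 ->
  permutable F1 B1 -> permutable F2 B2 -> ~ B1 F1 -> ~ B2 F2 ->
  B1 A1 -> B2 A2 -> A1 `&` A2 !=set0.
Proof.
move=> Tinf F1fin F2fin perm1 perm2 nBF1 nBF2 BA1 BA2.
apply: contrapT => /nonemptyPn A120.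
pose F := F1 `|` F2.
have Ffin : finite_set F by rewrite finite_setU.
have permF1 : permutable F B1.
  case: perm1 => ? inv; split=> // s sK sF; apply: inv => // x ?.
  by apply: sF; left.
have permF2 : permutable F B2.
  case: perm2 => ? inv; split=> // s sK sF; apply: inv => // x ?.
  by apply: sF; right.
have A12 x : A1 x -> ~ A2 x.
  by move=> A1x A2x; have : (A1 `&` A2) x by []; rewrite A120.
have [|s [sK sid sA]] := @matching_involution T (A1 `\` F) (A2 `\` F).
  by apply/seteqP; split=> // x [[/A12 nA2 _] []].
have sF x : F x -> s x = x by move=> Fx; apply: sid => -[].
case: sA => [s12|s21].
  apply: (permutable_infinite Tinf F1fin perm1 nBF1) Ffin.
  apply: (permutable_moved_off permF1 sK sF BA1) => x A1x nFx /A12.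
  by apply; apply: (s12 x _).1.
apply: (permutable_infinite Tinf F2fin perm2 nBF2) Ffin.
apply: (permutable_moved_off permF2 sK sF BA2) => x A2x nFx.
by apply: A12; apply: (s21 x _).1.
Qed.

End PermutableFilters.

(** * Permutations *)

Local Open Scope group_scope.
Local Coercion Sym_fun : Sym >-> Funclass.
Local Arguments Sym_fun : simpl never.

Section Permutations.
Variable X : Type.
Implicit Types (f g : Sym X) (x y : X).

Lemma SymM f g x : (f * g) x = g (f x).
Proof. by []. Qed.

Lemma SymK f x : f^-1 (f x) = x.
Proof. exact: Sym_funK. Qed.

Lemma SymVK f x : f (f^-1 x) = x.
Proof. exact: Sym_invfunK. Qed.

Lemma Sym_inj f : injective f.
Proof. exact: can_inj (SymK f). Qed.

Lemma involution_Sym (s : X -> X) : involutive s ->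
  exists c : Sym X, c =1 s /\ c^-1 = c.
Proof.
move=> sK; pose c := Sym_mk (Bijective sK sK); exists c; split=> //.
by apply: Sym_eqP => x; apply: (@Sym_inj c); rewrite SymVK -[RHS]/(s (s x)) sK.
Qed.

Lemma transposition x y : exists t : Sym X,
  [/\ t^-1 = t, t x = y, t y = x & forall z, z <> x -> z <> y -> t z = z].
Proof.
have [->|xy] := pselect (x = y); first by exists 1; rewrite invg1.
have [|s [sK sid sxy]] := @matching_involution X [set x] [set y].
  by apply/seteqP; split=> // z [/= -> ].
have [t [ts tV]] := involution_Sym sK; exists t.
have [sx sy] : s x = y /\ s y = x.
  by case: sxy => [/(_ x erefl)/= <-|/(_ y erefl)/= <-]; rewrite sK.
by split=> [|||z zx zy]; rewrite // ts // sid.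
Qed.

Lemma finite_Sym : finite_set [set: X] -> finite_set [set: Sym X].
Proof.
move=> /(@finite_seqP {classic X})[s sX].
pose h (f : Sym X) : {ffun seq_sub s -> option (seq_sub s)} :=
  [ffun u => insub (f (@ssval {classic X} s u) : {classic X})].
apply: (@finite_preimage _ _ setT h) finite_finset => f g _ _ fg.
have sP x : (x : {classic X}) \in s by have : [set: X] x by []; rewrite sX.
apply: Sym_eqP => x.
have := congr1 (fun k : {ffun seq_sub s -> option (seq_sub s)} =>
  k (SeqSub (sP x))) fg.
by rewrite /h !ffunE /= !insubT ?sP// => ? ? [].
Qed.

End Permutations.

(** * Neighbourhoods of the identity *)

Section UnitFilters.
Variable X : Type.
Implicit Types (N : set_system (Sym X)) (f g c : Sym X) (p q x y : X).

(** Axioms for the filter of neighbourhoods of 1 in a Hausdorff semigroup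
    topology, chosen so that they pass to the filter of inverses: the last one
    keeps from the separation axiom its consequence for transpositions, which is
    symmetric in p and p' under inversion. *)
Record unit_filter N : Prop := {
  unit_filter_filter :> Filter N ;
  unit_filterM : forall V, N V ->
    exists2 W, N W & forall f g, W f -> W g -> V (f * g) ;
  unit_filterJ : forall c V, N V -> N [set f : Sym X | V (c^-1 * f * c)] ;
  unit_filter_sep : forall p p' q, p <> q -> p' <> q -> p <> p' ->
    N [set f : Sym X | ~ (f p = p' /\ f q = q)]
}.

Definition inverse_filter N : set_system (Sym X) :=
  [set V | N [set f : Sym X | V f^-1]].

(** This replaces the continuity of inversion: statements about images under
    small permutations become statements about preimages. *)
Lemma unit_filterV N : unit_filter N -> unit_filter (inverse_filter N).
Proof.
move=> Nunit; have Nfilter := unit_filter_filter Nunit.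
split=> [|V NV|c V NV|p p' q pq p'q pp'].
- exact: (fmap_filter (fun f : Sym X => f^-1)).
- have [W NW WV] := unit_filterM Nunit NV.
  exists [set f : Sym X | W f^-1].
    by apply: (@filterS _ N) NW => f; rewrite /= invgK.
  by move=> f g Wf Wg; rewrite -[f * g]invgK invgM; exact: WV.
- apply: (@filterS _ N) (unit_filterJ Nunit c NV) => f /=.
  by rewrite !invgM invgK mulgA.
- have pp's : p' <> p by move=> /esym.
  apply: (@filterS _ N) (unit_filter_sep Nunit p'q pq pp's) => f nf [fp fq].
  by apply: nf; rewrite -fp SymVK -{1}fq SymVK.
Qed.

(** Conjugation by the transposition of x and y exchanges their stabilisers. *)
Lemma unit_filter_fix N x y : unit_filter N ->
  N [set f : Sym X | f x = x] -> N [set f : Sym X | f y = y].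
Proof.
move=> Nunit Nx; have Nfilter := unit_filter_filter Nunit.
have [t [tV tx ty _]] := transposition x y.
apply: (@filterS _ N) (unit_filterJ Nunit t Nx) => f /=.
by rewrite !SymM tV tx => /(congr1 t);
  rewrite -[t (t _)]/((t * t) _) -{1}tV mulVg tx.
Qed.

Lemma permutable_image N x : unit_filter N ->
  permutable [set x] [set A | N [set f : Sym X | A (f x)]].
Proof.
move=> Nunit; have Nfilter := unit_filter_filter Nunit.
split=> [|s sK sx A /= NA]; first exact: (fmap_filter (fun f : Sym X => f x)).
have [c [cs cV]] := involution_Sym sK.
apply: (@filterS _ N) (unit_filterJ Nunit c NA) => f /=.
by rewrite !SymM cV !cs (sx x).
Qed.

(** Once p is required to go to p', conjugation must preserve this requirement,
    hence fix p' as well as p and q. *)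
Lemma permutable_conditional_image N p p' q : unit_filter N ->
  permutable [set p; p'; q] [set A | N [set f : Sym X | f p = p' -> A (f q)]].
Proof.
move=> Nunit; have Nfilter := unit_filter_filter Nunit.
split=> [|s sK sF A /= NA].
  split=> [|A B NA NB|A B AB NA].
  - by apply: (@filterE _ N).
  - by apply: (@filterS _ N) (@filterI _ N _ _ _ NA NB) => f [fA fB] fp;
    split; auto.
  - by apply: (@filterS _ N) NA => f fA fp; apply: AB; exact: fA.
have [c [cs cV]] := involution_Sym sK.
apply: (@filterS _ N) (unit_filterJ Nunit c NA) => f /=.
have [sp sp' sq] : [/\ s p = p, s p' = p' & s q = q].
  by split; apply: sF; [left; left|left; right|right].
by rewrite !SymM cV !cs sp sq => + fp; apply; rewrite fp.
Qed.

Section SmallNeighbourhoods.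
Hypothesis Xinf : infinite_set [set: X].

Lemma exists_notin (F : set X) : finite_set F -> exists x, ~ F x.
Proof.
move=> Ffin.
by have [x [_ ?]] := infinite_setN0 (infinite_setD Xinf Ffin); exists x.
Qed.

(** The images of x and the preimages of y under a neighbourhood W with W W inside
    V meet in some z, and x goes to y through z. *)
Lemma unit_filter_transitive N : unit_filter N ->
  (forall x, ~ N [set f : Sym X | f x = x]) ->
  forall V x y, N V -> exists2 f, V f & f x = y.
Proof.
move=> Nunit Nmove V x y NV; have Nfilter := unit_filter_filter Nunit.
have [W NW WV] := unit_filterM Nunit NV.
have [|||z [[f Wf fz] [g Wg gz]]] := @permutable_meet X [set x] [set y] _ _
    [set f x | f in W] [set g^-1 y | g in W] Xinf (finite_set1 _) (finite_set1 _)
    (permutable_image x Nunit) (permutable_image y (unit_filterV Nunit))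
    (Nmove x).
- move=> NVy; apply: (Nmove y); apply: (@filterS _ N) NVy => f /= fy.
  by rewrite -{1}fy SymVK.
- by apply: (@filterS _ N) NW => f Wf; exists f.
- by apply: (@filterS _ N) NW => f Wf; exists f.
by exists (f * g); [exact: WV|rewrite SymM fz -gz SymVK].
Qed.

(** If f p = p' left only p, p', q as values of f q, conjugating by a transposition
    of q with a new point r would leave only p, p', r as values of f r. By
    transitivity some f close to 1 does map p to p'. Separation excludes f q = q and f r = r, and
    injectivity excludes p', so that f maps both q and r to p. *)
Lemma conditional_image_not_fixed N p p' q : unit_filter N ->
  (forall x, ~ N [set f : Sym X | f x = x]) -> p <> q -> p' <> q -> p <> p' ->
  ~ N [set f : Sym X | f p = p' -> [set p; p'; q] (f q)].
Proof.
move=> Nunit Nmove pq p'q pp' NF; have Nfilter := unit_filter_filter Nunit.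
have [r rF] : exists r, ~ [set p; p'; q] r by apply: exists_notin.
have [rp rp' rq] : [/\ r <> p, r <> p' & r <> q].
  by split=> e; apply: rF; rewrite e; [left; left|left; right|right].
have [t [tV tq tr tid]] := transposition q r.
have [tp tp'] : t p = p /\ t p' = p' by split; apply: tid => //; exact/nesym.
have NFr := unit_filterJ Nunit t NF.
have Nq := unit_filter_sep Nunit pq p'q pp'.
have Nr : N [set f : Sym X | ~ (f p = p' /\ f r = r)].
  by apply: unit_filter_sep => //; exact/nesym.
have [f [[[fF fFr] fq] fr] fp] :=
  unit_filter_transitive Nunit Nmove p p'
    (filterI (filterI (filterI NF NFr) Nq) Nr).
have fqp : f q = p.
  case: (fF fp) => [[//|fqp']|fqq]; last by case: fq.
  by case: pq; apply: (@Sym_inj _ f); rewrite fp fqp'.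
have : [set p; p'; q] (t (f r)).
  apply: contrapT => ntr; move: fFr.
  by rewrite /= !SymM tV tp fp tp' tq => /(_ erefl).
case=> [[/(congr1 t)|/(congr1 t)]|/(congr1 t)]; rewrite -{1}tV SymK.
- by rewrite tp => frp; apply: rq; apply: (@Sym_inj _ f); rewrite frp.
- by rewrite tp' => frp; apply: rp; apply: (@Sym_inj _ f); rewrite frp.
- by rewrite tq => frr; apply: fr.
Qed.

(** Otherwise p can be sent to p' through z by a product f g while q is brought
    back to q, against the separation property. *)
Lemma unit_filter_has_fix N : unit_filter N ->
  exists x, N [set f : Sym X | f x = x].
Proof.
move=> Nunit; have Nfilter := unit_filter_filter Nunit.
apply: contrapT => /forallNP Nmove.
have Vunit := unit_filterV Nunit.
have Vmove x : ~ inverse_filter N [set f : Sym X | f x = x].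
  move=> NVx; apply: (Nmove x); apply: (@filterS _ N) NVx => f /= fx.
  by rewrite -{1}fx SymVK.
have [p _] := exists_notin (@finite_set0 X).
have [q /nesym pq] := exists_notin (finite_set1 p).
have [p' /not_orP[/nesym pp' p'q]] := exists_notin (finite_set2 p q).
have [z /not_orP[/not_orP[zp zp'] zq]] := exists_notin (finite_set3 p p' q).
have [W NW WV] := unit_filterM Nunit (unit_filter_sep Nunit pq p'q pp').
have [||x [[f [Wf fp] fq] [g [Wg gp'] gq]]] := @permutable_meet X _ _ _ _
    [set f q | f in [set f : Sym X | W f /\ f p = z]]
    [set g^-1 q | g in [set g : Sym X | W g /\ g^-1 p' = z]] Xinf
    (finite_set3 p z q) (finite_set3 p' z q)
    (permutable_conditional_image p z q Nunit)
    (permutable_conditional_image p' z q Vunit)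
    (conditional_image_not_fixed Nunit Nmove pq zq (nesym zp))
    (conditional_image_not_fixed Vunit Vmove p'q zq (nesym zp')).
- by apply: (@filterS _ N) NW => f Wf /= fp; exists f.
- by apply: (@filterS _ N) NW => f Wf /= fp; exists f.
apply: (WV f g Wf Wg); rewrite !SymM fp fq.
by rewrite -gp' -gq !SymVK.
Qed.

End SmallNeighbourhoods.
End UnitFilters.

(** * Topologies on the symmetric group *)

Section PointwiseTopology.
Variable X : Type.
Implicit Types (c f g : Sym X) (x y : X).

Lemma nbhs_pointwise_eval f x :
  nbhs (f : pointwise_topology X) [set g : Sym X | g x = f x].
Proof.
(* Projections of a product are indexed by an eqType, hence {classic X}. *)
pose K (_ : {classic X}) : topologicalType := discrete_topology {classic X}.
have evalc : continuous
    ((@proj {classic X} K x : {ptws X -> discrete_topology {classic X}} -> K x)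
     \o (@Sym_incl X : pointwise_topology X -> _)).
  move=> g; apply: continuous_comp; first exact: initial_continuous.
  exact: (@proj_continuous {classic X} K x).
exact: (evalc f [set f x] (discrete_set1 (f x : discrete_topology {classic X}))).
Qed.

Lemma cvg_pointwise (F : set_system (Sym X)) f : Filter F ->
  (forall x, F [set g : Sym X | g x = f x]) -> F --> (f : pointwise_topology X).
Proof.
move=> Ffilter Feval A [_ [[U oU <-] Uf] UA].
apply: (@filterS _ F) UA _.
have : (@Sym_incl X @ F) -->
    (@Sym_incl X f : {ptws X -> discrete_topology {classic X}}).
  apply/cvg_sup => x B [_ [[V oV <-] Vf] VB].
  by apply: (@filterS _ F) (Feval x) => g gx; apply: VB; rewrite /= /Sym_incl gx.
by apply; apply: open_nbhs_nbhs.
Qed.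

Lemma pointwise_hausdorff : hausdorff_space (pointwise_topology X).
Proof.
move=> f g fg; apply: Sym_eqP => x.
have [h [hf hg]] := fg _ _ (@nbhs_pointwise_eval f x) (@nbhs_pointwise_eval g x).
by rewrite -hf.
Qed.

Lemma pointwise_semigroup_topology :
  semigroup_topology (Topological.class (pointwise_topology X)).
Proof.
move=> [f g]; apply: cvg_pointwise => x.
exists ([set h : Sym X | h x = f x], [set h : Sym X | h (f x) = g (f x)]).
  by split; exact: nbhs_pointwise_eval.
by move=> [h k] [/= hf kg]; rewrite /= !SymM hf.
Qed.

End PointwiseTopology.

Section HausdorffSemigroupTopology.
Variables (X : Type) (tau : Topological (Sym X)).
Let T : topologicalType := Topological.Pack tau.
Hypotheses (Thausdorff : hausdorff_space T) (Tmul : semigroup_topology tau).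
Implicit Types (c f g : Sym X) (x y : X).

Lemma nbhs_mull c f (V : set (Sym X)) :
  nbhs (c * f : T) V -> nbhs (f : T) [set g | V (c * g)].
Proof.
move=> /(@Tmul (c, f))[[A B] /= [NA NB] AB].
apply: (@filterS T _ _ _ _ _ NB) => g Bg; apply: (AB (c, g)).
by split=> //; exact: (@nbhs_singleton T c).
Qed.

Lemma nbhs_mulr c f (V : set (Sym X)) :
  nbhs (f * c : T) V -> nbhs (f : T) [set g | V (g * c)].
Proof.
move=> /(@Tmul (f, c))[[A B] /= [NA NB] AB].
apply: (@filterS T _ _ _ _ _ NA) => g Ag; apply: (AB (g, c)).
by split=> //; exact: (@nbhs_singleton T c).
Qed.

Lemma unit_filter_nbhs1 : unit_filter (nbhs (1 : T)).
Proof.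
split=> [|V NV|c V NV|p p' q pq p'q pp'].
- exact: (@nbhs_filter T (1 : Sym X)).
- have : nbhs ((1 : T) * 1 : T) V by rewrite mul1g.
  move=> /(@Tmul (1, 1))[[A B] /= [NA NB] AB]; exists (A `&` B).
    exact: filterI.
  by move=> f g [Af _] [_ Bg]; apply: (AB (f, g)).
- have : nbhs (c^-1 * 1 * c : T) V by rewrite mulg1 mulVg.
  by move=> /nbhs_mulr/nbhs_mull.
(* Separating the transpositions (p q) and (p' q) makes t * f and f * t'
   different for f near 1. *)
have [t [_ tp tq tid]] := transposition p q.
have [t' [_ tp' tq' tid']] := transposition p' q.
have tt' : t <> t' by move=> tt'; apply: (pq); rewrite -tp tt' tid'.
have [[A B]] : exists AB : set T * set T,
    [/\ nbhs (t : T) AB.1, nbhs (t' : T) AB.2 & AB.1 `&` AB.2 = set0].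
  apply: contrapT => /forallNP sep; apply: tt'; apply: Thausdorff => A B NA NB.
  by apply: contrapT => /nonemptyPn AB0; apply: (sep (A, B)).
move=> /= [NA NB AB0].
have NtA : nbhs (1 : T) [set f | A (t * f)].
  by apply: nbhs_mull; rewrite mulg1.
have NtB : nbhs (1 : T) [set f | B (f * t')].
  by apply: nbhs_mulr; rewrite mul1g.
apply: filterS (filterI NtA NtB) => f [/= Atf Bft] [fp fq].
have tfft : t * f = f * t'.
  apply: Sym_eqP => x; rewrite !SymM.
  have [->|xp] := pselect (x = p); first by rewrite tp fp fq tp'.
  have [->|xq] := pselect (x = q); first by rewrite tq fp fq tq'.
  by rewrite tid // tid' // => [fx|fx]; [apply: xp|apply: xq];
     apply: (@Sym_inj _ f); rewrite fx.
have : (A `&` B) (f * t') by split; rewrite // -tfft.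
by rewrite AB0.
Qed.

Lemma nbhs1_fix x : nbhs (1 : T) [set f : T | f x = x].
Proof.
have [Xfin|Xinf] := pselect (finite_set [set: X]).
  (* A finite Hausdorff space is discrete. *)
  apply: open_nbhs_nbhs; split=> //; rewrite -closedC.
  apply: (@accessible_finite_set_closed T).1; first exact: hausdorff_accessible.
  exact: sub_finite_set (finite_Sym Xfin).
have [y Ny] := unit_filter_has_fix Xinf unit_filter_nbhs1.
exact: unit_filter_fix unit_filter_nbhs1 Ny.
Qed.

Lemma open_pointwise_open (U : set (Sym X)) :
  open_sets (pointwise_topology X) U -> open_sets T U.
Proof.
move=> oU; rewrite /open_sets openE => f Uf.
suff: nbhs (f : T) --> (f : pointwise_topology X).
  by apply; apply: open_nbhs_nbhs.
apply: cvg_pointwise => x.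
have : nbhs (f * f^-1 : T) [set g : T | g x = x] by rewrite mulgV; exact: nbhs1_fix.
move=> /nbhs_mulr; apply: (@filterS T (nbhs (f : T))) => g /=.
by rewrite SymM => fgx; rewrite -{2}fgx SymVK.
Qed.

End HausdorffSemigroupTopology.

Theorem theorem1p20 (X : Type) :
  open_sets (HM (Sym X)) = open_sets (pointwise_topology X).
Proof.
apply/seteqP; split=> U oU.
  by apply: oU; [exact: pointwise_hausdorff|exact: pointwise_semigroup_topology].
by move=> tau Thausdorff Tmul; exact: open_pointwise_open.
Qed.
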